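(* Let $m$ be an integer with $m \equiv 1 \pmod 3$ such that $D = 9m^2+4m$ is square-free, and let $K=\mathbb{Q}(\sqrt{D})$ with class number $h_K$. If $m \notin \{-5, 1\}$, then $h_K \geq 3$.
   Context: $K=\mathbb{Q}(\sqrt{D})$ is a real quadratic field (note $D>0$ for such $m$); $h_K$ denotes the order of its (ordinary) ideal class group. *)

(* Defs.v *)
From mathcomp Require Import all_boot all_order all_algebra all_field.
From mathcomp Require Import finmap boolp classical_sets functions cardinality.

Set Implicit Arguments.
Unset Strict Implicit.
Unset Printing Implicit Defensive.

Import GRing.Theory Num.Theory.

Local Open Scope classical_set_scope.
Local Open Scope ring_scope.

Definition squarefreez (n : int) : Prop :=
  forall d : int, (d ^+ 2 %| n)%Z -> `|d|%N = 1%N.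

(* K = Q(sqrt n), up to isomorphism *)
Definition is_Qsqrt (K : fieldExtType rat) (n : int) : Prop :=
  exists2 s : K, s ^+ 2 = n%:~R & <<1; s>>%VS = fullv.

Section ClassGroup.

Variable K : fieldExtType rat.

Definition ring_of_integers : set K :=
  [set x | integralOver (intr : int -> K) x].

(* Nonzero fractional ideals, i.e. the elements of the group of fractional
   ideals *)
Definition fractional_ideal : set (set K) :=
  [set I : set K |
    [/\ I 0, exists2 x, I x & x != 0,
        forall x y, I x -> I y -> I (x + y),
        forall a x, ring_of_integers a -> I x -> I (a * x) &
        exists d : K, [/\ ring_of_integers d, d != 0 &
          forall x, I x -> ring_of_integers (d * x)]]].

Definition ideal_mul (I J : set K) : set K :=
  [set x | exists n (u v : 'I_n -> K),
    [/\ forall i, I (u i), forall i, J (v i) & x = \sum_i u i * v i]].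

(* The generator ranges over all of K^*, with no condition on its signs: the
   quotient is the ordinary class group, not the narrow one. *)
Definition principal_ideal : set (set K) :=
  [set (fun x => a * x) @` ring_of_integers | a in [set a : K | a != 0]].

Definition ideal_class (I : set K) : set (set K) :=
  [set ideal_mul I P | P in principal_ideal].

(* The quotient of the fractional ideals by the principal ones, as the set of
   cosets *)
Definition class_group : set (set (set K)) :=
  [set ideal_class I | I in fractional_ideal].

(* [fset_set] is empty on infinite sets, so a positive lower bound on this
   number includes the finiteness of the class group. *)
Definition class_number : nat := #|` fset_set class_group|.

End ClassGroup.

(* Main.v *)
Require Import Defs.
From mathcomp Require Import all_boot all_order all_algebra all_field.
From mathcomp Require Import finmap boolp classical_sets functions cardinality.
From mathcomp Require Import ring lra zify.

Set Implicit Arguments.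
Unset Strict Implicit.
Unset Printing Implicit Defensive.

Import Order.TTheory GRing.Theory Num.Theory.

Local Open Scope ring_scope.

(** Class group finiteness is Hurwitz's argument: by the pigeonhole principle
    some multiple [t xi], [1 <= t <= M], of any [xi] in [K] is within norm less
    than 1 of an element of [O]. Comparing with an element of minimal norm, every
    fractional ideal is homothetic to one between [T O] and [O], where [T = M!].

    Since [D = 1] modulo 3, the prime 3 splits into [P] and its conjugate [P'].
    We show that [O], [P] and [P'] lie in three distinct classes. If [P] or [P']
    is principal then, by conjugation, [P' = a P] for some [a], so it is enough
    to exclude this equality. Then [N a = 1] or [-1], and [6 a = X + Y sqrt D]
    with [X, Y] integers. The unit [(9 m + 2 + 3 sqrt D) / 2] of norm 1 is so
    small that choosing [|Y|] minimal among the associates of [a] gives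
    [(|9 m + 2| - 2) Y ^ 2 <= 81], which forces [Y = 0] (for [m = 7], because
    [469 + 36] and [469 - 36] are not squares). So [a] may be taken to be 1 or
    -1, whence [P = P'], a contradiction. *)

(** * Integrality and approximation over the rationals *)

(** The root descends to the rationals because [in_alg K] is injective, and is then moved to [algC],
    where a rational algebraic integer is an integer. *)
Lemma rational_integralOver (K : fieldExtType rat) (u : rat) :
  integralOver (intr : int -> K) u%:A -> u \is a Num.int.
Proof.
case=> p monp.
have -> : map_poly intr p = map_poly (in_alg K) (map_poly intr p).
  rewrite -map_poly_comp; apply: eq_map_poly => x /=.
  by rewrite -(rmorph_int (in_alg K)).
rewrite fmorph_root => rp; rewrite -Cint_rat.
apply: Cint_rat_Aint; first exact: Crat_rat.
apply: (@root_monic_Aint (map_poly intr p)).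
- have -> : map_poly intr p =
      map_poly (ratr : rat -> algC) (map_poly (intr : int -> rat) p).
    by rewrite -map_poly_comp; apply: eq_map_poly => x /=; rewrite ratr_int.
  by rewrite fmorph_root.
- by rewrite monic_map.
- by apply/polyOverP => i; rewrite coef_map /= intr_int.
Qed.

(** In lowest terms [denq w ^+ 2] is prime to [numq w ^+ 2], so it divides [D]. *)
Lemma squarefreez_rat_int (D : int) (w : rat) :
  squarefreez D -> D%:~R * w ^+ 2 \is a Num.int -> w \is a Num.int.
Proof.
move=> sqf /intrP[k hk].
have e : D * numq w ^+ 2 = k * denq w ^+ 2.
  apply: (@intr_inj rat); rewrite !expr2 !intrM -hk.
  by rewrite numqE; ring.
have : (denq w ^+ 2 %| D)%Z.
  rewrite -(@Gauss_dvdzl _ _ (numq w ^+ 2)); first by rewrite e dvdz_mull.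
  by rewrite coprimezXl // coprimezXr // coprimezE coprime_sym coprime_num_den.
move=> /sqf h; rewrite Qint_def; apply/eqP.
by have := denq_gt0 w; lia.
Qed.

(** Dirichlet's boxes: the box of [x] is the position of its fractional part in the unit interval
    cut into [n.+1] equal pieces. *)
Lemma rat_boxes (n : nat) : exists box : rat -> 'I_n.+1, forall x y,
  box x = box y -> exists p : int, n.+1%:R * `|x - y - p%:~R| < 1.
Proof.
pose f (x : rat) : rat := n.+1%:R * (x - (Num.floor x)%:~R).
have n0 : 0 < n.+1%:R :> rat by rewrite ltr0n.
have f_ge0 x : 0 <= f x by apply: mulr_ge0; [exact: ltW | rewrite subr_ge0 floor_le].
have f_lt x : f x < n.+1%:R.
  rewrite -[ltRHS]mulr1 ltr_pM2l // ltrBlDl.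
  by have /andP[_] := floor_itv x; rewrite intrD.
have g_ge0 x : 0 <= Num.floor (f x) by rewrite floor_ge0.
have g_lt x : (`|Num.floor (f x)| < n.+1)%N.
  have : (Num.floor (f x))%:~R < n.+1%:~R :> rat.
    by apply: le_lt_trans (f_lt x); apply: floor_le.
  by rewrite ltr_int; move: (g_ge0 x); lia.
exists (fun x => inord `|Num.floor (f x)|) => x y /(congr1 val).
rewrite /= !inordK // => e.
have {}e : Num.floor (f x) = Num.floor (f y).
  by move: (g_ge0 x) (g_ge0 y); lia.
exists (Num.floor x - Num.floor y).
have -> : n.+1%:R * `|x - y - (Num.floor x - Num.floor y)%:~R| = `|f x - f y|.
  by rewrite -{1}(ger0_norm (ltW n0)) -normrM /f rmorphB /=; congr `|_|; ring.
have /andP[] := floor_itv (f x); have /andP[] := floor_itv (f y).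
rewrite e intrD ltr_norml => *; lra.
Qed.

(** * Ideal classes as orbits under homothety *)

Section IdealClass.

Variable K : fieldExtType rat.

Local Notation O := (@ring_of_integers K).

Definition dilate (a : K) (I : set K) : set K := ((fun x => a * x) @` I)%classic.

Lemma dilateM a b I : dilate a (dilate b I) = dilate (a * b) I.
Proof.
apply/seteqP; split=> [_ [_ [x Ix <-] <-]|_ [x Ix <-]].
  by exists x; rewrite ?mulrA.
by exists (b * x); [exists x | rewrite mulrA].
Qed.

Lemma dilate1 I : dilate 1 I = I.
Proof.
by apply/seteqP; split=> [_ [x Ix <-]|x Ix]; rewrite ?mul1r //; exists x; rewrite ?mul1r.
Qed.

Lemma ideal_mul_principal I a : fractional_ideal I ->
  ideal_mul I (dilate a O) = dilate a I.
Proof.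
case=> I0 _ ID IM _; apply/seteqP; split=> [_ [n [u [v [Iu Ov ->]]]]|_ [x Ix <-]].
  elim/big_ind: _ => [|_ _ [x Ix <-] [y Iy <-]|i _].
  - by exists 0; rewrite ?mulr0.
  - by exists (x + y); rewrite ?mulrDr //; apply: ID.
  - case: (Ov i) => w Ow <-; exists (w * u i); first exact: IM.
    by ring.
exists 1%N, (fun=> x), (fun=> a); split=> // [_|].
  by exists 1; rewrite ?mulr1 //; apply: integral1.
by rewrite big_ord1 mulrC.
Qed.

(** With classes in this form, products of ideals no longer occur. *)
Lemma ideal_classE I : fractional_ideal I ->
  ideal_class I = [set dilate a I | a in [set a : K | a != 0]]%classic.
Proof.
move=> fI; apply/seteqP; split=> [_ [_ [a a0 <-] <-]|_ [a a0 <-]].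
  by exists a => //; rewrite -ideal_mul_principal.
by exists (dilate a O); [exists a | exact: ideal_mul_principal].
Qed.

Lemma ideal_class_inj I J : fractional_ideal I -> fractional_ideal J ->
  ideal_class I = ideal_class J -> exists2 a, a != 0 & J = dilate a I.
Proof.
move=> fI fJ e; have : ideal_class J J.
  by rewrite ideal_classE //; exists 1; [exact: oner_neq0 | exact: dilate1].
by rewrite -e ideal_classE // => -[a a0 <-]; exists a.
Qed.

Lemma fractional_ideal_O : fractional_ideal O.
Proof.
split.
- exact: integral0.
- by exists 1; [exact: integral1 | exact: oner_neq0].
- by move=> x y; exact: integral_add.
- by move=> x y; exact: integral_mul.
- exists 1; split; [exact: integral1 | exact: oner_neq0 | by move=> x; rewrite mul1r].
Qed.

Lemma class_number_ge3 (I J L : set K) : finite_set (@class_group K) ->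
  fractional_ideal I -> fractional_ideal J -> fractional_ideal L ->
  ideal_class I <> ideal_class J -> ideal_class I <> ideal_class L ->
  ideal_class J <> ideal_class L -> (3 <= class_number K)%N.
Proof.
move=> fin fI fJ fL IJ IL JL.
apply: (@uniq_leq_size (set (set K)) [:: ideal_class I; ideal_class J; ideal_class L]).
  rewrite !cons_uniq !in_cons in_nil !orbF negb_or !andbT -andbA.
  by apply/and3P; split; apply/eqP.
move=> C CIJL; rewrite -[_ \in _]/(C \in fset_set (@class_group K)) in_fset_set //.
move: CIJL; rewrite !in_cons in_nil orbF => CIJL; apply/mem_set.
by case/or3P: CIJL => /eqP ->; [exists I | exists J | exists L].
Qed.

(** For [c] the trace and [k] the norm of [x], the factor [x - c] is minus the conjugate, so the
    equation can be read off from the norm. *)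
Lemma integral_quadratic (c k : int) x : x * (x - c%:~R) + k%:~R = 0 -> O x.
Proof.
move=> h; exists ('X * ('X - c%:P) + k%:P).
  rewrite monicE lead_coefDl.
    by rewrite -monicE monicMl ?monicX ?monicXsubC.
  rewrite mulrC size_mulX ?polyXsubC_eq0 // size_XsubC.
  by rewrite (leq_ltn_trans (size_polyC_leq1 _)).
rewrite rmorphD rmorphM rmorphB /= map_polyX !map_polyC /= /root.
by rewrite !hornerE h.
Qed.

End IdealClass.

(** * Descent by the unit, in integers *)

(* [Y1] and [Y2] are the [Y]-coordinates, up to sign, after multiplication by the
   unit [(9 m + 2 + 3 sqrt D) / 2] and by its inverse. *)
Lemma unit_descent_bound (m X Y Y1 Y2 n : int) :
  X ^+ 2 - (9 * m ^+ 2 + 4 * m) * Y ^+ 2 = 36 * n -> `|n| = 1 ->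
  2 * Y1 = (9 * m + 2) * Y + 3 * X -> 2 * Y2 = (9 * m + 2) * Y - 3 * X ->
  `|Y| <= `|Y1| -> `|Y| <= `|Y2| -> (`|9 * m + 2| - 2) * Y ^+ 2 <= 81.
Proof.
move=> hn n1 h1 h2 le1 le2.
pose A := 3 * `|X|; pose B := `|9 * m + 2| * `|Y|; pose C := 2 * `|Y|.
have eB : `|(9 * m + 2) * Y| = B by rewrite normrM.
(* The smaller of [2 * |Y1|] and [2 * |Y2|] is [|A - B|], so [le1] and [le2] together say that
   [|A - B| >= C]. *)
have AB : A + C <= B \/ B + C <= A.
  rewrite /A /C -eB; move: h1 h2 le1 le2; clear; move: (_ * Y) => P; lia.
have C0 : 0 <= C by rewrite mulr_ge0.
have A0 : 0 <= A by rewrite mulr_ge0.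
have B0 : 0 <= B by rewrite mulr_ge0.
(* This is nine times the norm equation, as [9 * (9 * m ^+ 2 + 4 * m) = (9 * m + 2) ^+ 2 - 4]. *)
have eA : A ^+ 2 = B ^+ 2 - C ^+ 2 + 324 * n.
  rewrite /A /B /C !exprMn -!normrX !(ger0_norm (sqr_ge0 _)).
  apply/eqP; rewrite -subr_eq0; apply/eqP.
  transitivity (9 * (X ^+ 2 - (9 * m ^+ 2 + 4 * m) * Y ^+ 2 - 36 * n)).
    by ring.
  by rewrite hn; ring.
have eBC : B * C = 2 * `|9 * m + 2| * Y ^+ 2.
  by rewrite /B /C -[Y ^+ 2](ger0_norm (sqr_ge0 _)) normrX; ring.
have eC : C ^+ 2 = 4 * Y ^+ 2.
  by rewrite /C exprMn -normrX (ger0_norm (sqr_ge0 _)).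
(* Squaring either alternative of [AB] cancels [B ^+ 2] and leaves a bound on the cross term. *)
have le : B * C - C ^+ 2 <= 162.
  move: n1 AB A0 B0 C0 eA; clearbody A B C; clear; move=> n1 AB A0 B0 C0 eA.
  case: AB => AB.
    have : A ^+ 2 <= (B - C) ^+ 2 by rewrite ler_sqr ?nnegrE; lia.
    by rewrite eA sqrrB; lia.
  have : (B + C) ^+ 2 <= A ^+ 2 by rewrite ler_sqr ?nnegrE; lia.
  have : 0 <= C ^+ 2 by exact: sqr_ge0.
  by rewrite eA sqrrD; lia.
by move: le; rewrite eBC eC mulrBl -mulrA; clear; move: (`|_| * _) => P; lia.
Qed.

Lemma unit_descent (m X Y Y1 Y2 k : int) :
  (m = 1 %[mod 3])%Z -> (forall t, m != 2 * t) -> m \notin [:: -5; 1] ->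
  X ^+ 2 - (9 * m ^+ 2 + 4 * m) * Y ^+ 2 = 36 * k -> `|k| = 1 ->
  2 * Y1 = (9 * m + 2) * Y + 3 * X -> 2 * Y2 = (9 * m + 2) * Y - 3 * X ->
  `|Y| <= `|Y1| -> `|Y| <= `|Y2| -> Y = 0 /\ (X = 6 \/ X = -6).
Proof.
move=> /eqP m3 m_odd hm' eq1 k1 eY1 eY2 le1 le2.
have bound := unit_descent_bound eq1 k1 eY1 eY2 le1 le2.
move: m3; rewrite eqz_mod_dvd => /dvdzP[c hc].
have Y0 : Y = 0.
  apply/eqP/negP => /negP YN0.
  have Q1 : 1 <= Y ^+ 2 by rewrite -gtz0_ge1 exprn_even_gt0.
  have [m7|mN7] := eqVneq m 7.
    have Ysq : Y ^+ 2 = 1 by move: bound Q1; rewrite m7 /=; clear; lia.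
    have X2 : X * X = 505 \/ X * X = 433.
      by rewrite -expr2; move: eq1 k1; rewrite m7 Ysq; clear; lia.
    have {X2} : `|X| * `|X| = 505 \/ `|X| * `|X| = 433.
      by rewrite -normrM; clear -X2; lia.
    move: `|X| (normr_ge0 X) => z z0 z2.
    (* Both 433 and 505 lie strictly between the squares of 20 and 23, and neither is 441 or 484. *)
    have [z20|z20] := lerP z 20; first by clear -z0 z20 z2; nia.
    have [z22|z22] := lerP z 22; last by clear -z22 z2; nia.
    have : z = 21 \/ z = 22 by clear -z20 z22; lia.
    by case=> e; rewrite e in z2; clear -z2; lia.
  have T82 : 82 <= `|9 * m + 2| - 2.
    (* The [m] congruent to 1 modulo 3 with [|9 * m + 2| < 84] are -8, -5, -2, 1, 4 and 7; the even
       ones are twice -4, -1 and 2. *)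
    move: (m_odd (-4)) (m_odd (-1)) (m_odd 2) hm' mN7 hc; rewrite !inE.
    by clear; lia.
  move: bound; apply/negP; rewrite -ltNge; apply: (lt_le_trans (y := 82)) => //.
  by rewrite -[82]mulr1 ler_pM.
split=> //; have {eq1} : X ^+ 2 = 6 ^+ 2.
  have := sqr_ge0 X; move: eq1; rewrite Y0 expr0n mulr0 subr0 => ->.
  by clear -k1; lia.
by move/eqP; rewrite eqf_sqr => /orP[] /eqP; [left | right].
Qed.

(** * Coordinates, conjugation and norm in the quadratic field *)

Section QuadraticField.

Variables (K : fieldExtType rat) (D : int) (s : K).
Hypothesis sqrD : s ^+ 2 = D%:~R.
Hypothesis gen_s : <<1; s>>%VS = fullv.
Hypothesis D_nonsquare : forall u : rat, u ^+ 2 != D%:~R.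

Let E (u v : rat) : K := u%:A + v *: s.

Let basis : 2.-tuple K := [tuple 1; s].

Definition qre (z : K) : rat := coord basis ord0 z.
Definition qim (z : K) : rat := coord basis ord_max z.

Lemma basis_free : free basis.
Proof.
have s_irr u : s <> u%:A.
  move=> e; have /eqP := D_nonsquare u; apply; apply: (fmorph_inj (in_alg K)).
  by rewrite rmorphXn rmorph_int -sqrD e.
rewrite /basis /= free_cons span_seq1 seq1_free; apply/andP; split.
  apply/negP => /vlineP[k hk]; apply: (s_irr k^-1).
  have kn : k != 0.
    by apply/eqP => k0; have := oner_neq0 K; rewrite hk k0 scale0r eqxx.
  by rewrite hk scalerA mulVf // scale1r.
by apply/eqP => s0; apply: (s_irr 0); rewrite s0 scale0r.
Qed.

(** Horner evaluation at [s] stays in the span, because [s ^+ 2] is rational. *)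
Lemma span_basis_full z : z \in <<basis>>%VS.
Proof.
have : z \in <<1; s>>%VS by rewrite gen_s memvf.
case/Fadjoin_polyP => p pK ->.
have sD : forall u v, E u v * s = E (v * D%:~R) u.
  move=> u v; rewrite /E mulrDl -!scalerAl mul1r -expr2 sqrD addrC.
  by rewrite -[in RHS]scalerA; congr (_ *: _ + _); rewrite -(rmorph_int (in_alg K)).
suff [u [v ->]] : exists u v, p.[s] = E u v.
  by rewrite /= span_cons span_seq1 memv_add // memvZ // memv_line.
elim/poly_ind: p pK => [|p c ih] pK.
  by exists 0, 0; rewrite horner0 /E !scale0r addr0.
have [u [v e]] : exists u v, p.[s] = E u v.
  apply: ih; apply/polyOverP => i; have /polyOverP/(_ i.+1) := pK.
  by rewrite coefD coefMX coefC addr0.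
have : c \in 1%VS.
  by have /polyOverP/(_ 0%N) := pK; rewrite coefD coefMX coefC add0r.
case/vlineP => k ->; exists (v * D%:~R + k), u.
by rewrite hornerMXaddC e sD /E scalerDl addrAC.
Qed.

Lemma qE z : z = E (qre z) (qim z).
Proof.
rewrite [LHS](coord_span (span_basis_full z)) 2!big_ord_recl big_ord0 addr0.
by rewrite /E /qre /qim; congr (_ + coord _ _ _ *: _); apply: val_inj.
Qed.

Lemma qreE u v : qre (E u v) = u.
Proof.
rewrite /qre /E linearD !linearZ /= (coord_free ord0 ord0 basis_free).
by rewrite (coord_free ord_max ord0 basis_free) /= mulr1 mulr0 addr0.
Qed.

Lemma qimE u v : qim (E u v) = v.
Proof.
rewrite /qim /E linearD !linearZ /= (coord_free ord0 ord_max basis_free).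
by rewrite (coord_free ord_max ord_max basis_free) /= mulr1 mulr0 add0r.
Qed.

Lemma q_inj y z : qre y = qre z -> qim y = qim z -> y = z.
Proof. by move=> a b; rewrite (qE y) (qE z) a b. Qed.

Lemma EM u v u' v' :
  E u v * E u' v' = E (u * u' + D%:~R * v * v') (u * v' + v * u').
Proof.
have h x : x%:A = in_alg K x by [].
have h2 x y : x *: y = in_alg K x * y :> K by rewrite /= -scalerAl mul1r.
rewrite /E !h !h2 !rmorphD !rmorphM rmorph_int -sqrD.
by ring.
Qed.

Lemma qreD y z : qre (y + z) = qre y + qre z.
Proof. by rewrite /qre linearD. Qed.
Lemma qimD y z : qim (y + z) = qim y + qim z.
Proof. by rewrite /qim linearD. Qed.
Lemma qreZ k z : qre (k *: z) = k * qre z.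
Proof. by rewrite /qre linearZ. Qed.
Lemma qimZ k z : qim (k *: z) = k * qim z.
Proof. by rewrite /qim linearZ. Qed.
Lemma qreM y z : qre (y * z) = qre y * qre z + D%:~R * qim y * qim z.
Proof. by rewrite {1}(qE y) {1}(qE z) EM qreE. Qed.
Lemma qimM y z : qim (y * z) = qre y * qim z + qim y * qre z.
Proof. by rewrite {1}(qE y) {1}(qE z) EM qimE. Qed.
Lemma qre_rat k : qre k%:A = k.
Proof. by rewrite -[X in qre X]addr0 -(scale0r s) qreE. Qed.
Lemma qim_rat k : qim k%:A = 0.
Proof. by rewrite -[X in qim X]addr0 -(scale0r s) qimE. Qed.
Definition qconj (z : K) : K := E (qre z) (- qim z).
Definition qnorm (z : K) : rat := qre z ^+ 2 - D%:~R * qim z ^+ 2.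

Lemma qre_conj z : qre (qconj z) = qre z.
Proof. exact: qreE. Qed.
Lemma qim_conj z : qim (qconj z) = - qim z.
Proof. exact: qimE. Qed.

Lemma qre_int (k : int) : qre k%:~R = k%:~R.
Proof. by rewrite -(rmorph_int (in_alg K)) qre_rat. Qed.
Lemma qim_int (k : int) : qim k%:~R = 0.
Proof. by rewrite -(rmorph_int (in_alg K)) qim_rat. Qed.

(** Conjugation commutes with integer polynomials, so it permutes their roots and preserves
    integrality. *)
Lemma qconj_horner (p : {poly int}) z :
  (map_poly intr p).[qconj z] = qconj (map_poly (intr : int -> K) p).[z].
Proof.
elim/poly_ind: p => [|p c ih].
  rewrite rmorph0 !horner0; apply: q_inj; rewrite ?qre_conj ?qim_conj //.
  by rewrite /qim linear0 oppr0.
rewrite rmorphD rmorphM /= map_polyX map_polyC /= !hornerMXaddC ih.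
apply: q_inj; rewrite ?(qre_conj, qim_conj) ?(qreD, qimD) ?(qre_int, qim_int).
  by rewrite !qreM !qre_conj !qim_conj; ring.
by rewrite !qimM !qre_conj !qim_conj; ring.
Qed.

Local Notation O := (@ring_of_integers K).

Lemma integral_conj z : O z -> O (qconj z).
Proof.
case=> p monp /rootP rp; exists p => //; apply/rootP.
rewrite qconj_horner rp; apply: q_inj; rewrite ?qre_conj ?qim_conj //.
by rewrite /qim linear0 oppr0.
Qed.

Lemma mulr_conj z : z * qconj z = (qnorm z)%:A.
Proof.
apply: q_inj; rewrite (qreM, qimM) ?(qre_rat, qim_rat) !qre_conj !qim_conj /qnorm; ring.
Qed.

Lemma qnormM y z : qnorm (y * z) = qnorm y * qnorm z.
Proof. by rewrite /qnorm qreM qimM; ring. Qed.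

(** Otherwise [D] would be the square of [qre z / qim z]. *)
Lemma qnorm_eq0 z : qnorm z = 0 -> z = 0.
Proof.
rewrite /qnorm => /eqP; rewrite subr_eq0 => /eqP h.
have [im0|imN0] := eqVneq (qim z) 0.
  have re0 : qre z = 0 by apply/eqP; rewrite -sqrf_eq0 h im0 expr0n mulr0.
  by rewrite (qE z) re0 im0 /E !scale0r addr0.
have /eqP[] := D_nonsquare (qre z / qim z).
by rewrite expr_div_n h mulfK // sqrf_eq0.
Qed.

Lemma integral_norm z : O z -> qnorm z \is a Num.int.
Proof.
move=> Oz; apply: (@rational_integralOver K); rewrite -mulr_conj.
exact: integral_mul Oz (integral_conj Oz).
Qed.

Lemma integral_trace z : O z -> 2 * qre z \is a Num.int.
Proof.
move=> Oz; apply: (@rational_integralOver K).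
have -> : (2 * qre z)%:A = z + qconj z.
  apply: q_inj; rewrite ?(qre_rat, qim_rat) 1?(qreD, qimD) ?qre_conj ?qim_conj; ring.
exact: integral_add Oz (integral_conj Oz).
Qed.

(** * Integral elements and finiteness of the class group *)

Hypothesis D_sqfree : squarefreez D.

(** The trace is an integer, and [D * (2 * qim z) ^+ 2] is its square minus four times the norm; as
    [D] is square-free, [2 * qim z] has no denominator. *)
Lemma integral_coords z : O z ->
  exists x y : int, qre z = x%:~R / 2 /\ qim z = y%:~R / 2.
Proof.
move=> Oz; have /intrP[x hx] := integral_trace Oz.
have /intrP[y hy] : 2 * qim z \is a Num.int.
  apply: squarefreez_rat_int D_sqfree _.
  have -> : D%:~R * (2 * qim z) ^+ 2 = (2 * qre z) ^+ 2 - 4 * qnorm z.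
    by rewrite /qnorm; ring.
  apply: rpredB; first exact/rpredX/integral_trace.
  by apply: rpredM; [exact: (rpred_nat _ 4) | exact: integral_norm].
by exists x, y; rewrite -hx -hy; split; field.
Qed.

Lemma integral_s : O s.
Proof.
exists ('X^2 - D%:P); first by apply: monicXnsubC.
by rewrite rmorphB /= map_polyXn map_polyC /= /root !hornerE sqrD subrr.
Qed.

Lemma integral_intr (k : int) : O k%:~R.
Proof. exact: integral_id. Qed.

Lemma integral_E (p q : int) : O (E p%:~R q%:~R).
Proof.
have -> : E p%:~R q%:~R = p%:~R + q%:~R * s.
  by rewrite /E !scaler_int mulrzl.
apply: integral_add; first exact: integral_intr.
exact: integral_mul (integral_intr q) integral_s.
Qed.

(** Hurwitz's substitute for Euclidean division: two multiples of [xi] whose coordinates share their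
    boxes differ by nearly an element of [Z[s]], and [t] is the difference of their indices. *)
Lemma qnorm_approx : exists M : nat, forall xi : K,
  exists t g, [/\ (0 < t <= M)%N, O g & `|qnorm (t%:R *: xi - g)| < 1].
Proof.
pose n := `|D|.+1; have [box boxP] := rat_boxes n.
exists (n.+1 ^ 2)%N => xi.
(* Counting [t = 0], there is one more multiple than there are pairs of boxes. *)
pose f (t : 'I_(n.+1 ^ 2).+1) := (box (t%:R * qre xi), box (t%:R * qim xi)).
have /injectivePn[i [j ij fij]] : ~~ injectiveb f.
  apply/negP => /injectiveP/leq_card.
  by rewrite card_prod !card_ord mulnn ltnn.
wlog lt_ji : i j ij fij / (j < i)%N.
  move=> hw; have [lt_ji|lt_ij|/val_inj e] := ltngtP (val j) (val i).
  - exact: hw ij fij lt_ji.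
  - by apply: (hw j i) => //; rewrite eq_sym.
  - by rewrite e eqxx in ij.
case: fij => /boxP[p hp] /boxP[q hq].
exists (i - j)%N, (E p%:~R q%:~R); split; [|exact: integral_E|].
  by rewrite subn_gt0 lt_ji (leq_trans (leq_subr _ _)) // -ltnS ltn_ord.
move: hp hq; rewrite -!mulrBl -natrB ?(ltnW lt_ji) //.
rewrite /qnorm !(qreD, qimD) -scaleN1r !(qreZ, qimZ) qreE qimE !mulN1r.
set a := _ - p%:~R; set b := _ - q%:~R => ha hb.
(* This dictates [n]: both coordinate errors are below [1 / n.+1], so the norm is at most
   [(1 + |D|) / n.+1 ^+ 2] in absolute value. *)
have hn : 1 + `|D|%:~R < n.+1%:R ^+ 2 :> rat.
  by rewrite -(intrD _ 1) -[n.+1%:R]/(n.+1%:~R) -rmorphXn /= ltr_int /n; nia.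
have n0 : 0 < n.+1%:R :> rat by rewrite ltr0n.
have sq (x : rat) : n.+1%:R * `|x| < 1 -> n.+1%:R ^+ 2 * x ^+ 2 < 1.
  move=> hx; rewrite -[x ^+ 2]ger0_norm ?sqr_ge0 // normrX -exprMn.
  by rewrite expr_lt1 // mulr_ge0 // ltW.
have {ha hb} [ha hb] := (sq _ ha, sq _ hb).
rewrite -(ltr_pM2l (exprn_gt0 2 n0)) mulr1; apply: (le_lt_trans _ hn).
have n2 : 0 <= n.+1%:R ^+ 2 :> rat by rewrite exprn_ge0 ?ltW.
rewrite -[X in X * `|_|](ger0_norm n2) -normrM mulrBr.
apply: le_trans (ler_normB _ _) _; apply: lerD.
  by rewrite ger0_norm ?(ltW ha) // mulr_ge0 ?sqr_ge0.
rewrite mulrCA normrM -intr_norm ler_piMr ?ler0z ?normr_ge0 //.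
by rewrite ger0_norm ?(ltW hb) // mulr_ge0 ?sqr_ge0.
Qed.

(** Norms of integral elements are integers, so their absolute values are well-ordered. *)
Lemma min_norm (I : set K) : fractional_ideal I -> (forall x, I x -> O x) ->
  exists a, [/\ I a, a != 0 & forall x, I x -> `|qnorm x| < `|qnorm a| -> x = 0].
Proof.
case=> _ [x0 Ix0 x00] _ _ _ IO.
pose P n := `[< exists x, [/\ I x, x != 0 & `|qnorm x| = n%:R] >].
have exP x : I x -> x != 0 -> exists2 n, P n & `|qnorm x| = n%:R.
  move=> Ix xn0; have /intrP[k hk] := integral_norm (IO _ Ix).
  have e : `|qnorm x| = `|k|%N%:R by rewrite hk -intr_norm.
  by exists `|k|%N => //; apply/asboolP; exists x.
have [n0 Pn0 _] := exP _ Ix0 x00.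
case: (ex_minnP (ex_intro (fun n => P n) _ Pn0)) => n /asboolP[a [Ia a0 ha]] minn.
exists a; split=> // x Ix; rewrite ha => lt; apply/eqP/negP => /negP xn0.
have [k Pk hk] := exP _ Ix xn0.
by move: lt; rewrite hk ltr_nat ltnNge minn.
Qed.

Lemma bounded_representative : exists2 T : nat, (0 < T)%N & forall I : set K,
  fractional_ideal I -> exists c, [/\ c != 0, dilate c I T%:R &
    forall x, dilate c I x -> O x].
Proof.
have [M approx] := qnorm_approx; exists M`!; first exact: fact_gt0.
move=> I [I0 [x0 Ix0 x00] ID IM [d [Od d0 dI]]].
have fdI : fractional_ideal (dilate d I).
  split.
  - by exists 0; rewrite ?mulr0.
  - by exists (d * x0); [exists x0 | rewrite mulf_neq0].
  - by move=> _ _ [x Ix <-] [y Iy <-]; exists (x + y); [exact: ID | rewrite mulrDr].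
  - by move=> a _ Oa [x Ix <-]; exists (a * x); [exact: IM | rewrite mulrCA].
  - exists 1; split; [exact: integral1 | exact: oner_neq0 |].
    by move=> _ [x Ix <-]; rewrite mul1r; exact: dI.
have [|a [dIa a0 mina]] := min_norm fdI; first by move=> _ [x Ix <-]; exact: dI.
(* Multiplication by [d] makes the ideal integral; the other factor sends the element [a] of minimal
   norm to [M!]. *)
exists (M`!%:R / a * d); rewrite -dilateM; split.
- rewrite !mulf_eq0 invr_eq0 !negb_or a0 d0 -(rmorph_nat (in_alg K)) fmorph_eq0.
  by rewrite pnatr_eq0 -lt0n fact_gt0.
- by exists a => //; rewrite mulfVK.
move=> _ [b dIb <-]; have [t [g [/andP[t0 tM] Og lt1]]] := approx (b / a).
(* This element of [dilate d I] is [a] times one of norm less than 1, so minimality kills it. Hence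
   [b / a = g / t], where [t] divides [M!]. *)
have e : t%:R * b - g * a = 0.
  apply: mina.
    case: fdI => _ _ addI mulI _; rewrite -mulNr.
    apply: addI; apply: mulI => //; first exact: integral_nat.
    exact: integral_opp.
  have -> : t%:R * b - g * a = (t%:R *: (b / a) - g) * a.
    by rewrite scaler_nat -[_ / a *+ t]mulr_natl mulrBl -(mulrA t%:R) mulfVK.
  rewrite qnormM normrM gtr_pMl // normr_gt0.
  by apply/eqP => /qnorm_eq0 /eqP; exact/negP.
have /dvdnP[k hk] : (t %| M`!)%N by rewrite dvdn_fact // t0.
have -> : M`!%:R / a * b = k%:R * g.
  rewrite hk natrM; apply: (mulIf a0); rewrite -[RHS]mulrA.
  by rewrite -(subr0_eq e); field.
by apply: integral_mul => //; exact: integral_nat.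
Qed.

(** An ideal between [T O] and [O] is stable under translation by [T Z[s]], and its elements have
    half-integral coordinates. The representatives [(i + j s) / 2] with [i, j < 2 T] that it
    contains therefore determine it. *)
Lemma class_group_finite : finite_set (@class_group K).
Proof.
have [T T0 repr] := bounded_representative.
pose lat (A : {set 'I_(2 * T) * 'I_(2 * T)}) : set K :=
  [set z | exists ij, ij \in A /\ exists p q : int,
     z = E (ij.1%:R / 2) (ij.2%:R / 2) + T%:R *: E p%:~R q%:~R]%classic.
pose cl A : set (set K) := [set dilate a (lat A) | a in [set a : K | a != 0]]%classic.
apply: (@sub_finite_set _ _ (cl @` [set: {set 'I_(2 * T) * 'I_(2 * T)}])%classic);
  last exact: finite_image.
move=> _ [I fI <-]; have [c [c0 JT JO]] := repr _ fI.
have [JD JM] : (forall x y, dilate c I x -> dilate c I y -> dilate c I (x + y)) /\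
    (forall a x, O a -> dilate c I x -> dilate c I (a * x)).
  case: fI => _ _ ID IM _; split.
    by move=> _ _ [x Ix <-] [y Iy <-]; exists (x + y); [exact: ID | rewrite mulrDr].
  by move=> a _ Oa [x Ix <-]; exists (a * x); [exact: IM | rewrite mulrCA].
have JT_E (p q : int) : dilate c I (T%:R *: E p%:~R q%:~R).
  by rewrite scaler_nat -mulr_natr; apply: JM => //; exact: integral_E.
pose A := [set ij : 'I_(2 * T) * 'I_(2 * T) |
  `[< dilate c I (E (ij.1%:R / 2) (ij.2%:R / 2)) >]]%SET.
have JE : dilate c I = lat A.
  apply/seteqP; split=> [z Jz|_ [ij [+ [p [q ->]]]]]; last first.
    by rewrite inE => /asboolP Jij; exact/JD/JT_E.
  have [x [y [hx hy]]] := integral_coords (JO _ Jz).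
  have T2 : (2 * T)%:Z != 0 by rewrite -lt0n muln_gt0.
  (* Halves of integers modulo [T] correspond to integers modulo [2 * T]. *)
  have digit (w : int) : exists (i : 'I_(2 * T)) (p : int),
      w%:~R / 2 = i%:R / 2 + T%:R * p%:~R :> rat.
    have h : (`|(w %% (2 * T)%:Z)%Z| < 2 * T)%N.
      by have := modz_ge0 w T2; have := @ltz_pmod w (2 * T)%:Z; lia.
    exists (Ordinal h), (w %/ (2 * T)%:Z)%Z => /=.
    rewrite {1}(divz_eq w (2 * T)%:Z) natr_absz ger0_norm ?modz_ge0 //.
    by rewrite rmorphD rmorphM /= PoszM rmorphM /=; field.
  have [[i [p hi]] [j [q hj]]] := (digit x, digit y).
  have ez : z = E (i%:R / 2) (j%:R / 2) + T%:R *: E p%:~R q%:~R.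
    by apply: q_inj; rewrite 1?(qreD, qimD) 1?(qreZ, qimZ) !(qreE, qimE) ?hx ?hy.
  exists (i, j); split; last by exists p, q.
  rewrite inE; apply/asboolP => /=.
  have -> : E (i%:R / 2) (j%:R / 2) = z + T%:R *: E (- p)%:~R (- q)%:~R.
    by rewrite ez /E !rmorphN /= !scaleNr -opprD scalerN addrK.
  exact/JD/JT_E.
exists A => //; rewrite ideal_classE // /cl -JE.
apply/seteqP; split=> _ [a a0 <-].
  by exists (a * c); [rewrite /= mulf_neq0 | rewrite dilateM].
by exists (a / c); [rewrite /= mulf_neq0 ?invr_eq0 | rewrite dilateM mulfVK].
Qed.


(** * The two primes above 3 *)

Lemma qconjM y z : qconj (y * z) = qconj y * qconj z.
Proof.
apply: q_inj; first by rewrite qre_conj !qreM !qre_conj !qim_conj; ring.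
by rewrite qim_conj !qimM !qre_conj !qim_conj; ring.
Qed.

Lemma qconjK : involutive qconj.
Proof. by move=> z; apply: q_inj; rewrite ?qre_conj // !qim_conj opprK. Qed.

(* For [e = 1] or [-1] and [D = 1] modulo 3, the kernel of the ring morphism
   from [O] to [F_3] that sends [s] to [e]. *)
Definition prime3 (e : int) : set K :=
  [set z | O z /\ exists x y : int,
    [/\ qre z = x%:~R / 2, qim z = y%:~R / 2 & (3 %| x + e * y)%Z]]%classic.

Lemma half_intr_inj (x y : int) : x%:~R / 2 = y%:~R / 2 :> rat -> x = y.
Proof. by move=> h; apply: (@intr_inj rat); lra. Qed.

Lemma prime3_3 e : prime3 e 3.
Proof.
split; first exact: (integral_intr 3).
exists 6, 0; rewrite -[3]/(3%:~R) qre_int qim_int mulr0 addr0.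
by split; [field | rewrite mul0r | ].
Qed.

(** Stability under [O] is multiplicativity of [x + e * y] modulo 3, up to a factor 2 coming from
    the halves: the defect is [(D - e ^+ 2) * q * y], a multiple of 3. *)
Lemma fractional_prime3 e : e ^+ 2 = 1 -> (3 %| D - 1)%Z ->
  fractional_ideal (prime3 e).
Proof.
move=> e2 /dvdzP[l hl]; split.
- split; first exact: integral0.
  by exists 0, 0; rewrite mulr0 !mul0r -[0 : K]/(0%:~R) qre_int qim_int.
- exists 3; first exact: prime3_3.
  by rewrite -(rmorph_nat (in_alg K)) fmorph_eq0.
- move=> z w [Oz [x [y [hx hy xy]]]] [Ow [x' [y' [hx' hy' xy']]]].
  split; first exact: integral_add.
  exists (x + x'), (y + y'); rewrite qreD qimD hx hy hx' hy' !rmorphD /= !mulrDl.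
  by split=> //; rewrite mulrDr addrACA rpredD.
- move=> a z Oa [Oz [x [y [hx hy /dvdzP[k xy]]]]].
  have Oaz := integral_mul Oa Oz; split=> //.
  have [p [q [hp hq]]] := integral_coords Oa.
  have [X [Y [hX hY]]] := integral_coords Oaz; exists X, Y; split=> //.
  have eX : 2 * X = p * x + D * q * y.
    apply: (@intr_inj rat); rewrite rmorphD !rmorphM /=.
    by move: hX; rewrite qreM hx hy hp hq; lra.
  have eY : 2 * Y = p * y + q * x.
    apply: (@intr_inj rat); rewrite rmorphD !rmorphM /=.
    by move: hY; rewrite qimM hx hy hp hq; lra.
  (* From [2 * N = 3 * W] follows [N = 3 * (N - W)]; here [N = X + e * Y]. *)
  apply/dvdzP; exists ((X + e * Y) - ((p + e * q) * k + l * q * y)).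
  have hD : D = l * 3 + 1 by rewrite -hl subrK.
  have : 2 * X + e * (2 * Y) = 3 * ((p + e * q) * k + l * q * y).
    have hx3 : x = k * 3 - e * y by rewrite -xy addrK.
    transitivity (3 * ((p + e * q) * k + l * q * y) + q * y * (1 - e ^+ 2)).
      by rewrite eX eY hD hx3; ring.
    by rewrite e2 subrr mulr0 addr0.
  lia.
- exists 1; split; [exact: integral1 | exact: oner_neq0 |].
  by move=> z [Oz _]; rewrite mul1r.
Qed.

Lemma prime3_conj e z : prime3 e z -> prime3 (- e) (qconj z).
Proof.
case=> Oz [x [y [hx hy xy]]]; split; first exact: integral_conj.
exists x, (- y); rewrite qre_conj qim_conj hx hy rmorphN /= mulNr.
by split=> //; rewrite mulrNN.
Qed.

(** Starting from 3, multiplying by [a] and conjugating, twice over, shows that [3 * qnorm a] lies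
    in [prime3 e]; the rational numbers there are multiples of 3. *)
Lemma prime3_quotient_norm e a :
  (forall z, prime3 e z -> prime3 (- e) (a * z)) -> qnorm a \is a Num.int.
Proof.
move=> ha; have : prime3 e (qnorm a * 3)%:A.
  have -> : (qnorm a * 3)%:A = qconj (a * qconj (a * 3)).
    rewrite qconjM qconjK mulrA [qconj a * a]mulrC mulr_conj.
    rewrite -[3 in RHS](rmorph_nat (in_alg K)).
    by rewrite -[LHS]/(in_alg K _) rmorphM.
  rewrite -[e]opprK; apply/prime3_conj/ha.
  rewrite -[e]opprK; apply/prime3_conj/ha.
  exact: prime3_3.
case=> /rational_integralOver/intrP[j hj] [x [y [+ + /dvdzP[k]]]].
rewrite qre_rat qim_rat hj => hx /esym/(half_intr_inj (y := 0)) -> hk.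
(* With [3 * qnorm a = j] and [2 * j = 3 * k], one has [j / 3 = j - k]. *)
apply/intrP; exists (j - k).
have : x = 2 * j by apply: (@intr_inj rat); rewrite rmorphM /=; lra.
move=> hx2; have hk3 : j * 2 = k * 3 by lia.
move/(congr1 (intr : int -> rat)): hk3; rewrite !rmorphM rmorphB /=; lra.
Qed.

(** Both [a] and [a^-1] have integral norms, and these are inverse to each other. *)
Lemma prime3_quotient_norm1 e a : a != 0 -> dilate a (prime3 e) = prime3 (- e) ->
  `|qnorm a| = 1.
Proof.
move=> a0 h.
have /intrP[i hi] : qnorm a \is a Num.int.
  by apply: (@prime3_quotient_norm e) => z Pz; rewrite -h; exists z.
have /intrP[j hj] : qnorm a^-1 \is a Num.int.
  apply: (@prime3_quotient_norm (- e)) => z; rewrite -h opprK => -[w Pw <-].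
  by rewrite mulKf.
have : i * j = 1.
  apply: (@intr_inj rat); rewrite rmorphM /= -hi -hj -qnormM divff //.
  by rewrite /qnorm -[1 in LHS]/(1%:~R) qre_int qim_int; ring.
move=> ij; rewrite hi -intr_norm.
have : (i %| 1)%Z by apply/dvdzP; exists j; rewrite mulrC.
by rewrite -abszE dvdz1 => /eqP ->.
Qed.

Lemma dilate_unit e u v : O u -> O v -> u * v = 1 -> e ^+ 2 = 1 ->
  (3 %| D - 1)%Z -> dilate u (prime3 e) = prime3 e.
Proof.
move=> Ou Ov uv e2 D3; have [_ _ _ PM _] := fractional_prime3 e2 D3.
apply/seteqP; split=> [_ [z Pz <-]|z Pz]; first exact: PM.
by exists (v * z); [exact: PM | rewrite mulrA uv mul1r].
Qed.


(** * The two primes above 3 are not homothetic *)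

Lemma prime3_not_associate (m : int) (a : K) :
  (m = 1 %[mod 3])%Z -> D = 9 * m ^+ 2 + 4 * m -> m \notin [:: -5; 1] ->
  a != 0 -> dilate a (prime3 1) <> prime3 (-1).
Proof.
move=> m3 eD hm' a0 ha.
have /dvdzP[c hc] : (3 %| m - 1)%Z by rewrite -eqz_mod_dvd; apply/eqP.
have D3 : (3 %| D - 1)%Z.
  apply/dvdzP; exists (3 * m ^+ 2 + m + c); rewrite eD; lia.
(* The norm is 1 because [(9 * m + 2) ^+ 2 - 9 * D = 4]. *)
pose u := E ((9 * m + 2)%:~R / 2) (3 / 2).
have norm_u : u * qconj u = 1.
  rewrite mulr_conj /qnorm qreE qimE eD.
  by rewrite -[RHS](scale1r 1); congr (_ *: _); field.
have Ou : O u.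
  apply: (@integral_quadratic _ (9 * m + 2) 1).
  have -> : u - (9 * m + 2)%:~R = - qconj u.
    apply: q_inj; rewrite -[- qconj u]scaleN1r -[- _%:~R]scaleN1r 1?(qreD, qimD).
      by rewrite !qreZ qreE qre_int qre_conj qreE; field.
    by rewrite !qimZ qimE qim_int qim_conj qimE; field.
  by rewrite mulrN norm_u addNr.
have Ou' := integral_conj Ou.
have P1u : dilate u (prime3 1) = prime3 1 by exact: dilate_unit norm_u _ _.
have P1u' : dilate (qconj u) (prime3 1) = prime3 1.
  by apply: (@dilate_unit _ _ u) => //; rewrite mulrC.
(* Since 3 lies in [prime3 1], the product [b * 3] is integral, whence the denominator 6. *)
have coords b : dilate b (prime3 1) = prime3 (-1) -> exists X Y : int,
    qre b = X%:~R / 6 /\ qim b = Y%:~R / 6.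
  move=> hb; have [] : prime3 (-1) (b * 3).
    by rewrite -hb; exists 3 => //; exact: prime3_3.
  move=> _ [X [Y [hX hY _]]]; exists X, Y; move: hX hY.
  rewrite -[3]/(3%:~R) qreM qimM qre_int qim_int; lra.
(* The minimum is taken over all multipliers [b], a set stable under [u] and its inverse
   [qconj u]. *)
pose P n := `[< exists b Y, [/\ dilate b (prime3 1) = prime3 (-1), b != 0,
  qim b = Y%:~R / 6 & `|Y|%N = n] >].
have exP : exists n, P n.
  have [X [Y [_ hY]]] := coords _ ha.
  by exists `|Y|%N; apply/asboolP; exists a, Y.
case: (ex_minnP exP) => n /asboolP[b [Y [hb b0 hY hn]]] minn {exP}.
have [X [_ [hX _]]] := coords _ hb.
have nb : `|qnorm b| = 1 by exact: (@prime3_quotient_norm1 1).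
have /intrP[k hk] : qnorm b \is a Num.int.
  apply: (@prime3_quotient_norm 1) => z Pz; rewrite -hb; by exists z.
have k1 : `|k| = 1 by apply: (@intr_inj rat); rewrite intr_norm -hk.
have eq1 : X ^+ 2 - (9 * m ^+ 2 + 4 * m) * Y ^+ 2 = 36 * k.
  apply: (@intr_inj rat); rewrite -eD rmorphB [RHS]rmorphM /= -hk /qnorm hX hY.
  by field.
have step v : O v -> v != 0 -> dilate v (prime3 1) = prime3 1 ->
    exists2 Z, qim (b * v) = Z%:~R / 6 & `|Y| <= `|Z|.
  move=> Ov v0 hv; have hbv : dilate (b * v) (prime3 1) = prime3 (-1).
    by rewrite -dilateM hv.
  have [_ [Z [_ hZ]]] := coords _ hbv; exists Z => //.
  have : (n <= `|Z|)%N.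
    by apply: minn; apply/asboolP; exists (b * v), Z; split=> //; rewrite mulf_neq0.
  by rewrite -hn; lia.
have u0 : u != 0.
  by apply/eqP => u0; have := oner_neq0 K; rewrite -norm_u u0 mul0r eqxx.
have u'0 : qconj u != 0.
  by apply/eqP => u0'; have := oner_neq0 K; rewrite -norm_u u0' mulr0 eqxx.
have [Y1 hY1 le1] := step _ Ou u0 P1u.
have [Y2 hY2 le2] := step _ Ou' u'0 P1u'.
have eY1 : 2 * Y1 = (9 * m + 2) * Y + 3 * X.
  apply: (@intr_inj rat); move: hY1; rewrite qimM hX hY qreE qimE.
  lra.
have eY2 : 2 * Y2 = (9 * m + 2) * Y - 3 * X.
  apply: (@intr_inj rat); move: hY2; rewrite qimM hX hY qre_conj qim_conj qreE qimE.
  lra.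
have m_odd t : m != 2 * t.
  apply/eqP => mt; have : (2 ^+ 2 %| D)%Z.
    by apply/dvdzP; exists (9 * t ^+ 2 + 2 * t); rewrite eD mt; ring.
  by move/D_sqfree.
have [Y0 X6] := unit_descent m3 m_odd hm' eq1 k1 eY1 eY2 le1 le2.
(* Now [b] is 1 or -1. The element [s - 1] lies in [prime3 1], but sending [s] to -1 gives -2, so it
   is outside [prime3 (-1)]. *)
pose w := E (-1)%:~R 1%:~R.
have [_ [x [y [hx hy /dvdzP[l hl]]]]] : prime3 (-1) (b * w).
  rewrite -hb; exists w => //; split; first exact: integral_E.
  by exists (-2), 2; rewrite qreE qimE; split; [field | field |].
have hx3 : x * 3 = - X.
  by apply: (@intr_inj rat); move: hx; rewrite qreM hX hY Y0 qreE qimE; lra.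
have hy3 : y * 3 = X.
  by apply: (@intr_inj rat); move: hy; rewrite qimM hX hY Y0 qreE qimE; lra.
clear -X6 hx3 hy3 hl; lia.
Qed.

(** * Three distinct classes *)

Lemma class_number_quadratic_ge3 (m : int) :
  (m = 1 %[mod 3])%Z -> D = 9 * m ^+ 2 + 4 * m -> m \notin [:: -5; 1] ->
  (3 <= class_number K)%N.
Proof.
move=> m3 eD hm'.
have D3 : (3 %| D - 1)%Z.
  have /dvdzP[c hc] : (3 %| m - 1)%Z by rewrite -eqz_mod_dvd; apply/eqP.
  by apply/dvdzP; exists (3 * m ^+ 2 + m + c); rewrite eD; lia.
have fP1 := @fractional_prime3 1 (erefl _) D3.
have fP2 := @fractional_prime3 (-1) (erefl _) D3.
have nassoc a := @prime3_not_associate m a m3 eD hm'.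
have conjO e a : dilate a O = prime3 e -> dilate (qconj a) O = prime3 (- e).
  move=> h; apply/seteqP; split=> [_ [w Ow <-]|z Pz].
    rewrite -[w]qconjK -qconjM; apply: prime3_conj; rewrite -h.
    by exists (qconj w) => //; exact: integral_conj.
  have : dilate a O (qconj z) by rewrite h -[e]opprK; exact: prime3_conj.
  case=> w Ow hw; exists (qconj w); first exact: integral_conj.
  by rewrite -qconjM hw qconjK.
have conj_neq0 a : a != 0 -> qconj a != 0.
  apply: contraNneq => h; rewrite -[a]qconjK h.
  by rewrite /qconj /qre /qim !linear0 oppr0 /E !scale0r addr0.
have notO a : a != 0 -> prime3 1 <> dilate a O.
  (* If [a] generates one prime, [qconj a] generates the other, so [qconj a / a] would carry the
     first to the second. *)
  move=> a0 /esym h; apply: (nassoc (qconj a / a)).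
    by rewrite mulf_neq0 ?invr_eq0 ?conj_neq0.
  by rewrite -h dilateM mulfVK // (conjO 1).
apply: (class_number_ge3 class_group_finite (fractional_ideal_O K) fP1 fP2).
- by case/(ideal_class_inj (fractional_ideal_O K) fP1) => a /notO.
- case/(ideal_class_inj (fractional_ideal_O K) fP2) => a a0 h.
  by apply: (notO _ (conj_neq0 _ a0)); rewrite (conjO (-1)).
- by case/(ideal_class_inj fP1 fP2) => a a0 /esym; exact: nassoc.
Qed.

End QuadraticField.

Theorem theorem1p2 (m D : int) (K : fieldExtType rat)
    (hm : (m = 1 %[mod 3])%Z) (hD : D = 9 * m ^+ 2 + 4 * m)
    (hsf : squarefreez D) (hK : is_Qsqrt K D) (hm' : m \notin [:: -5; 1]) :
  (3 <= class_number K)%N.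
Proof.
have [s s2 gen_s] := hK.
apply: (class_number_quadratic_ge3 s2 gen_s _ hsf hm hD hm') => u.
(* A rational square that is a square-free integer equals 1. But [D = 1] makes [m] divide 1, while
   [m = 1] and [m = -1] give [D = 13] and [D = 5]. *)
apply/eqP => u2.
have /intrP[k hk] : u \is a Num.int.
  apply: (@squarefreez_rat_int 1).
    by move=> d; rewrite dvdz1 abszX -mulnn muln_eq1 andbb => /eqP.
  by rewrite mul1r u2 intr_int.
have Dk : D = k ^+ 2 by apply: (@intr_inj rat); rewrite -u2 hk rmorphXn.
have k1 : `|k|%N = 1%N by apply: hsf; rewrite Dk.
have D1 : D = 1 by rewrite Dk; nia.
have : (m %| 1)%Z.
  apply/dvdzP; exists (9 * m + 4).
  by transitivity D => //; rewrite hD; ring.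
rewrite dvdz1 => /eqP m1; have [e|e] : m = 1 \/ m = -1 by clear -m1; lia.
  by move: hD; rewrite D1 e.
by move: hD; rewrite D1 e.
Qed.
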